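(* Let $\kappa$ be a singular (uncountable) cardinal with $2^{<\kappa}=\kappa$, and let $X$ be a nonempty regular Hausdorff space of weight at most $\kappa$ such that every open subset of $X$ is a union of at most $\operatorname{cof}(\kappa)$-many closed sets (i.e. $\kappa\text{-}\boldsymbol{\Sigma}^0_1(X)\subseteq\operatorname{cof}(\kappa)^+\text{-}\boldsymbol{\Sigma}^0_2(X)$). Given $0<\alpha<\kappa^+$, let $\widehat{\alpha}=\operatorname{cof}(\alpha)$ if $\alpha$ is limit, and $\widehat{\alpha}=\operatorname{cof}(\kappa)$ otherwise. Then: (1) If $\alpha$ is even, then $\kappa\text{-}\boldsymbol{\Sigma}^0_{1+\alpha}(X)$ is closed under unions of size $\kappa$ and intersections of size smaller than $\widehat{\alpha}$. Therefore $\kappa\text{-}\boldsymbol{\Pi}^0_{1+\alpha}(X)$ is closed under intersections of size $\kappa$ and unions of size smaller than $\widehat{\alpha}$, and $\kappa\text{-}\boldsymbol{\Delta}^0_{1+\alpha}(X)$ is a $\widehat{\alpha}$-algebra. (2) If $\alpha$ is odd, then $\kappa\text{-}\boldsymbol{\Sigma}^0_{1+\alpha}(X)=\kappa\text{-}\boldsymbol{\Pi}^0_{1+\alpha}(X)=\kappa\text{-}\boldsymbol{\Delta}^0_{1+\alpha}(X)$ is a $\operatorname{cof}(\kappa)$-algebra. Furthermore, the same is true for $\alpha=0$ (with $\widehat{0}=\operatorname{cof}(\kappa)$) if $X$ is $\operatorname{cof}(\kappa)$-additive.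
   Context: For a topological space $X$ and an ordinal $\gamma>\omega$, define by recursion on ordinals $\alpha\ge 1$: $\gamma\text{-}\boldsymbol{\Sigma}^0_1(X)$ is the family of open sets; for $\alpha>1$, $\gamma\text{-}\boldsymbol{\Sigma}^0_\alpha(X)$ is the family of all unions $\bigcup_{\xi<\delta}A_\xi$ with $\delta<\gamma$ and each $A_\xi\in\bigcup_{1\le\beta<\alpha}\gamma\text{-}\boldsymbol{\Pi}^0_\beta(X)$; $\gamma\text{-}\boldsymbol{\Pi}^0_\alpha(X)$ is the family of complements of sets in $\gamma\text{-}\boldsymbol{\Sigma}^0_\alpha(X)$; $\gamma\text{-}\boldsymbol{\Delta}^0_\alpha(X)=\gamma\text{-}\boldsymbol{\Sigma}^0_\alpha(X)\cap\gamma\text{-}\boldsymbol{\Pi}^0_\alpha(X)$. Every ordinal $\alpha$ is written uniquely as $\alpha=\lambda+n$ with $n<\omega$ and $\lambda=0$ or $\lambda$ limit; $\alpha$ is even (odd) if $n$ is even (odd). A $\nu$-algebra on $X$ is a family of subsets of $X$ closed under complements and well-ordered unions of length less than $\nu$. A space is $\nu$-additive if the intersection of any collection of fewer than $\nu$-many open sets is open. *)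

(* Defs.v *)
From mathcomp Require Import all_boot.
From mathcomp Require Import boolp classical_sets functions cardinality.
From mathcomp Require Import topology.
From mathcomp Require wochoice.

Set Implicit Arguments.
Unset Strict Implicit.
Unset Printing Implicit Defensive.

Local Open Scope classical_set_scope.
Local Open Scope card_scope.

(* An ordinal is represented by a well-ordered type; equality of ordinals is
   order isomorphism [oeq], not Leibniz equality. *)
Record Ord := MkOrd {
  ord_car :> Type;
  ord_lt : ord_car -> ord_car -> Prop;
  ord_wf : well_founded ord_lt;
  ord_trans : forall x y z, ord_lt x y -> ord_lt y z -> ord_lt x z;
  ord_total : forall x y, [\/ ord_lt x y, x = y | ord_lt y x] }.

Arguments ord_lt {_} _ _.

Definition oeq (a b : Ord) : Prop :=
  exists f : a -> b,
    bijective f /\ forall x y, ord_lt x y <-> ord_lt (f x) (f y).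

Lemma sval_inj T (P : T -> Prop) : injective (@sval T P).
Proof. by move=> [x hx] [y hy] /= xy; subst y; congr exist. Qed.

Section Seg.
Variables (a : Ord) (x : a).

Definition seg_lt (u v : {y : a | ord_lt y x}) : Prop :=
  ord_lt (sval u) (sval v).

Lemma seg_wf : well_founded seg_lt.
Proof.
move=> [u hu]; elim/(well_founded_ind (@ord_wf a)): u hu => u IH hu.
by constructor=> -[v hv] vu; apply: IH.
Qed.

Lemma seg_trans u v w : seg_lt u v -> seg_lt v w -> seg_lt u w.
Proof. exact: ord_trans. Qed.

Lemma seg_total u v : [\/ seg_lt u v, u = v | seg_lt v u].
Proof.
case: (ord_total (sval u) (sval v)); rewrite /seg_lt.
- by constructor 1.
- by move=> uv; constructor 2; apply: sval_inj.
- by constructor 3.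
Qed.

Definition seg : Ord := MkOrd seg_wf seg_trans seg_total.

Definition in_seg (y : a) (yx : ord_lt y x) : seg := exist _ y yx.
End Seg.

Definition olt (b a : Ord) : Prop := exists x : a, oeq b (seg x).

Lemma nat_wf : well_founded (fun i j : nat => (i < j)%N).
Proof. by move=> n; elim/ltn_ind: n => n IH; constructor. Qed.

Lemma nat_tot (i j : nat) : [\/ (i < j)%N, i = j | (j < i)%N].
Proof. by case: ltngtP; [constructor 1|constructor 3|constructor 2]. Qed.

Definition omega : Ord :=
  @MkOrd nat (fun i j => (i < j)%N) nat_wf
    (fun x y z h1 h2 => ltn_trans h1 h2) nat_tot.

Lemma ofin_wf n : well_founded (fun i j : 'I_n => (i < j)%N).
Proof.
move=> [i hi]; elim/ltn_ind: i hi => i IH hi.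
by constructor=> -[j hj] /= ji; apply: IH.
Qed.

Lemma ofin_tot n (i j : 'I_n) : [\/ (i < j)%N, i = j | (j < i)%N].
Proof.
case: (nat_tot i j); [by constructor 1| |by constructor 3].
by move/val_inj; constructor 2.
Qed.

Definition ofin (n : nat) : Ord :=
  @MkOrd 'I_n (fun i j => (i < j)%N) (@ofin_wf n)
    (fun x y z h1 h2 => ltn_trans h1 h2) (@ofin_tot n).

Section Add.
Variables a b : Ord.

Definition add_lt (u v : a + b) : Prop :=
  match u, v with
  | inl x, inl y => ord_lt x y
  | inl _, inr _ => True
  | inr _, inl _ => False
  | inr x, inr y => ord_lt x y
  end.

Lemma add_wf : well_founded add_lt.
Proof.
have L x : Acc add_lt (inl x).
  elim/(well_founded_ind (@ord_wf a)): x => x IH.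
  by apply: Acc_intro => -[y|y] yx; [exact: IH|case: yx].
case=> y; first exact: L.
elim/(well_founded_ind (@ord_wf b)): y => y IH.
by apply: Acc_intro => -[z|z] zy; [exact: L|exact: IH].
Qed.

Lemma add_trans u v w : add_lt u v -> add_lt v w -> add_lt u w.
Proof. by case: u v w => [x|x] [y|y] [z|z] //; exact: ord_trans. Qed.

Lemma add_total u v : [\/ add_lt u v, u = v | add_lt v u].
Proof.
case: u v => [x|x] [y|y] /=; [|by constructor 1|by constructor 3|];
  case: (ord_total x y); by [constructor 1|move=> ->; constructor 2|constructor 3].
Qed.

Definition oadd : Ord := MkOrd add_wf add_trans add_total.
End Add.

Section Basics.
Implicit Types a b c : Ord.

Lemma oeq_refl a : oeq a a.
Proof. by exists id; split=> //; exists id. Qed.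

Lemma oeq_sym a b : oeq a b -> oeq b a.
Proof.
move=> [f [[g fK gK] hf]]; exists g; split; first by exists f.
by move=> x y; rewrite hf !gK.
Qed.

Lemma oeq_trans a b c : oeq a b -> oeq b c -> oeq a c.
Proof.
move=> [f [bf hf]] [g [bg hg]]; exists (g \o f); split; first exact: bij_comp.
by move=> x y; rewrite hf hg.
Qed.

Lemma oeq_seg a b (x : a) : oeq a b -> exists y : b, oeq (seg x) (seg y).
Proof.
move=> [f [[g fK gK] hf]]; exists (f x).
have h1 (u : seg x) : ord_lt (f (sval u)) (f x) by apply/hf; exact: (svalP u).
have h2 (v : seg (f x)) : ord_lt (g (sval v)) x.
  by apply/hf; rewrite gK; exact: (svalP v).
exists (fun u => in_seg (h1 u)); split; last by move=> u v; exact: hf.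
exists (fun v => in_seg (h2 v)) => u; apply: sval_inj; [exact: fK|exact: gK].
Qed.

Lemma seg_seg a (x : a) (u : seg x) : oeq (seg u) (seg (sval u)).
Proof.
have h1 (v : seg u) : ord_lt (sval (sval v)) (sval u) by exact: (svalP v).
have h0 (v : seg (sval u)) : ord_lt (sval v) x.
  exact: ord_trans (svalP v) (svalP u).
have h2 (v : seg (sval u)) : ord_lt (in_seg (h0 v)) u.
  exact: (svalP v).
exists (fun v => in_seg (h1 v)); split; last by move=> v w; split; exact: id.
exists (fun v => in_seg (h2 v)) => v; last exact: sval_inj.
by do 2!apply: sval_inj.
Qed.

Lemma olt_seg a (x y : a) : ord_lt x y -> olt (seg x) (seg y).
Proof. by move=> xy; exists (in_seg xy); apply: oeq_sym; exact: seg_seg. Qed.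

Lemma seg_olt a (x : a) : olt (seg x) a.
Proof. by exists x; exact: oeq_refl. Qed.

Lemma olt_oeq a b c : olt a b -> oeq b c -> olt a c.
Proof.
move=> [x ax] /(oeq_seg x)[y xy]; exists y; exact: oeq_trans xy.
Qed.

Lemma oeq_olt a b c : oeq a b -> olt b c -> olt a c.
Proof. by move=> ab [x bx]; exists x; apply: oeq_trans bx. Qed.

Lemma olt_trans a b c : olt a b -> olt b c -> olt a c.
Proof.
move=> ab [x bx]; have [u au] := olt_oeq ab bx; exists (sval u).
exact: oeq_trans au (seg_seg u).
Qed.

Lemma olt_wf : well_founded olt.
Proof.
move=> a; constructor=> b [x bx].
elim/(well_founded_ind (@ord_wf a)): x b bx => x IH b bx.
constructor=> c cb; have [u cu] := olt_oeq cb bx.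
exact: IH (svalP u) _ (oeq_trans cu (seg_seg u)).
Qed.

Lemma olt_irr a : ~ olt a a.
Proof. by elim: (olt_wf a) => {}a _ IH aa; exact: (IH a aa aa). Qed.

Lemma wf_least T (R : T -> T -> Prop) (P : T -> Prop) : well_founded R ->
  (exists x, P x) -> exists2 x, P x & forall y, R y x -> ~ P y.
Proof.
move=> wfR [x Px]; apply: contrapT => nex.
elim: (wfR x) Px => {}x _ IH Px; apply: nex; exists x => // y; exact: IH.
Qed.

Let all_olt_oeq a b : (forall x : a, olt (seg x) b) ->
  (forall y : b, olt (seg y) a) -> oeq a b.
Proof.
move=> /choice[f hf] /choice[g hg].
have seg_inj c (x y : c) : oeq (seg x) (seg y) -> x = y.
  move=> xy; case: (ord_total x y) => // /olt_seg h; exfalso.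
    by apply: (@olt_irr (seg y)); apply: oeq_olt h; exact: oeq_sym.
  by apply: (@olt_irr (seg x)); apply: oeq_olt h.
have fmono x y : ord_lt x y -> ord_lt (f x) (f y).
  move=> xy; have lxy : olt (seg (f x)) (seg (f y)).
    apply: olt_oeq (hf y); apply: oeq_olt (olt_seg xy).
    exact/oeq_sym/hf.
  case: (ord_total (f x) (f y)) => // [eq|/olt_seg h]; exfalso.
    by move: lxy; rewrite eq; exact: olt_irr.
  by apply: olt_irr (olt_trans h lxy).
exists f; split.
  exists g => x; apply: seg_inj; first exact/oeq_sym/(oeq_trans (hf _) (hg _)).
  exact/oeq_sym/(oeq_trans (hg _) (hf _)).
move=> x y; split=> [|fxy]; first exact: fmono.
case: (ord_total x y) => // [eq|/fmono h]; exfalso.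
  by move: fxy; rewrite eq => /olt_seg /olt_irr.
exact: olt_irr (olt_trans (olt_seg h) (olt_seg fxy)).
Qed.

Let segs_olt a b : (forall x : a, olt (seg x) b) -> oeq a b \/ olt a b.
Proof.
move=> ab; case: (pselect (forall y : b, olt (seg y) a)) => [ba|].
  by left; exact: all_olt_oeq.
move=> /existsNP /(wf_least (@ord_wf b)) [y nya min]; right; exists y.
apply: all_olt_oeq => [x|u]; last first.
  by apply: oeq_olt (seg_seg u) _; apply: contrapT => h; exact: min (svalP u) h.
have [z xz] := ab x; case: (ord_total z y).
- by move=> /olt_seg zy; exact: oeq_olt zy.
- by move=> eq; case: nya; exists x; rewrite -eq; exact: oeq_sym.
- move=> /olt_seg yz; case: nya; apply: olt_trans (seg_olt x).
  exact: olt_oeq yz (oeq_sym xz).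
Qed.

Lemma olt_total a b : [\/ olt a b, oeq a b | olt b a].
Proof.
case: (pselect (forall x : a, olt (seg x) b)) => [/segs_olt[]|].
- by constructor 2.
- by constructor 1.
move=> /existsNP /(wf_least (@ord_wf a)) [x nxb min].
have [|h|//] := @segs_olt (seg x) b; last by constructor 3; exists x; exact: oeq_sym.
move=> u; apply: oeq_olt (seg_seg u) _; apply: contrapT => h.
exact: min (svalP u) h.
Qed.

(* The least ordinal satisfying P, unique up to [oeq]; junk if there is none. *)
Definition is_least (P : Ord -> Prop) a := P a /\ forall b, olt b a -> ~ P b.

Definition least (P : Ord -> Prop) : Ord :=
  if pselect (exists a, is_least P a) is left ex then projT1 (cid ex)
  else ofin 0.

Lemma leastP (P : Ord -> Prop) : (exists a, P a) -> is_least P (least P).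
Proof.
move=> /(wf_least olt_wf)[a Pa mina]; rewrite /least.
case: pselect => [ex|]; first by case: (cid ex).
by case; exists a.
Qed.

Lemma least_uniq (P : Ord -> Prop) a b :
  is_least P a -> is_least P b -> oeq a b.
Proof.
by move=> [Pa ma] [Pb mb]; case: (olt_total a b) => // [/mb|/ma].
Qed.

Definition is_limit a : Prop :=
  ~ oeq a (ofin 0) /\ ~ exists b, oeq a (oadd b (ofin 1)).

Definition parity_decomp a (l : Ord) (n : nat) : Prop :=
  (oeq l (ofin 0) \/ is_limit l) /\ oeq a (oadd l (ofin n)).

Definition is_even a : Prop := exists l n, parity_decomp a l n /\ ~~ odd n.
Definition is_odd a : Prop := exists l n, parity_decomp a l n /\ odd n.

Definition is_cardinal a : Prop :=
  forall b, olt b a -> [set: b] #!= [set: a].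

Definition succ_card a : Ord := least (fun m => is_cardinal m /\ olt a m).

Definition cofinal_map a b (f : b -> a) : Prop :=
  forall x : a, exists y : b, x = f y \/ ord_lt x (f y).

Definition cof a : Ord := least (fun b => exists f : b -> a, cofinal_map f).

(* 2 ^ (< a), the supremum of the cardinals 2 ^ l for cardinals l < a *)
Definition weak_pow2 a : Ord :=
  least (fun m => is_cardinal m /\
    forall l, is_cardinal l -> olt l a -> [set: set l] #<= [set: m]).

Definition singular a : Prop :=
  [/\ is_cardinal a, olt omega a & olt (cof a) a].

Definition cof_hat (k a : Ord) : Ord :=
  if pselect (is_limit a) then cof a else cof k.

End Basics.

Definition card_lt T U (A : set T) (B : set U) : bool :=
  (A #<= B) && ~~ (B #<= A).
Notation "A '#<' B" := (card_lt A B) (at level 79) : card_scope.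

Section WellDefined.
Implicit Types a b c : Ord.

Let inj_le T U (f : T -> U) : injective f -> [set: T] #<= [set: U].
Proof.
move=> fi; apply: card_le_trans (card_leT (f @` [set: T])).
have : f @` [set: T] #= [set: T] by apply: inj_card_eq => x y _ _; exact: fi.
by rewrite card_eq_le => /andP[].
Qed.

Lemma oeq_card a b : oeq a b -> [set: a] #= [set: b].
Proof.
move=> [f [[g fK gK] _]]; rewrite card_eq_le.
by rewrite (inj_le (can_inj fK)) (inj_le (can_inj gK)).
Qed.

Lemma olt_card a b : olt a b -> [set: a] #<= [set: b].
Proof.
move=> [x /oeq_card]; rewrite card_eq_le => /andP[h _]; apply: card_le_trans h _.
exact: inj_le (@sval_inj _ _).
Qed.

Lemma cof_spec a :
  is_least (fun b => exists f : b -> a, cofinal_map f) (cof a).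
Proof. by apply: leastP; exists a, id => x; exists x; left. Qed.

Lemma ord_of_type T : exists a, [set: a] #= [set: T].
Proof.
have [R Rwo] := wochoice.well_ordering_principle {classic T}.
have wc : wochoice.wo_chain R predT by move=> A _; exact: Rwo.
have tot (x y : {classic T}) : R x y || R y x by apply: (wochoice.wo_chainW wc).
have anti (x y : {classic T}) : R x y -> R y x -> x = y.
  by move=> xy yx; apply: (wochoice.wo_chain_antisymmetric wc) => //; rewrite xy.
have wf : well_founded (fun x y : {classic T} => ~~ R y x).
  move=> x; apply: contrapT => nx.
  have [|z [[+ zmin] _]] := Rwo [pred y | `[< ~ Acc (fun x y => ~~ R y x) y >]].
    by exists x; apply/asboolP.
  move=> /asboolP; apply; constructor=> y; apply: contraNP => ny.
  by apply: zmin; apply/asboolP.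
have trans (x y z : {classic T}) : ~~ R y x -> ~~ R z y -> ~~ R z x.
  move=> yx zy; apply/negP => zx.
  have [|m [[+ mmin] _]] := Rwo [pred w | [|| w == x, w == y | w == z]].
    by exists x; rewrite inE eqxx.
  rewrite inE => /or3P[] /eqP ?; subst m.
  - have /negP := zy; apply.
    have xz : R x z by apply: mmin; rewrite inE eqxx !orbT.
    by rewrite (anti _ _ zx xz); apply: mmin; rewrite inE eqxx orbT.
  - by have /negP := yx; apply; apply: mmin; rewrite inE eqxx.
  - by have /negP := zy; apply; apply: mmin; rewrite inE eqxx orbT.
have total (x y : {classic T}) : [\/ ~~ R y x, x = y | ~~ R x y].
  case: (boolP (R x y)) => [xy|]; last by constructor 3.
  case: (boolP (R y x)) => [yx|]; last by constructor 1.
  by constructor 2; exact: anti.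
by exists (MkOrd wf trans total).
Qed.

Lemma card_of_type T : exists2 a, is_cardinal a & [set: a] #= [set: T].
Proof.
have [a aT min] := wf_least olt_wf (ord_of_type T); exists a => // b ba.
by apply/negP => hb; apply: (min b ba); exact: card_eq_trans aT.
Qed.

Let cantor T : ~ ([set: set T] #<= [set: T]).
Proof.
move=> /card_leP[f].
pose g (A : set T) : T := sval (f (to_setT A)).
have gi : injective g.
  move=> A B /val_inj /(@inj _ _ _ f); rewrite !in_setT => /(_ isT isT).
  by move/(congr1 sval).
pose D : set T := [set x | exists2 A, g A = x & ~ A x].
have : D (g D) <-> ~ D (g D).
  split=> [[A /gi -> //]|nD]; by exists D.
by tauto.
Qed.

Lemma succ_card_spec a :
  is_least (fun m => is_cardinal m /\ olt a m) (succ_card a).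
Proof.
apply: leastP; have [m cm] := card_of_type (set a).
rewrite card_eq_le => /andP[_ am]; exists m; split=> //.
case: (olt_total a m) => // [/oeq_card|/olt_card ma].
  rewrite card_eq_le => /andP[_ ma]; exfalso.
  exact: cantor (card_le_trans am ma).
exfalso; exact: cantor (card_le_trans am ma).
Qed.

Lemma weak_pow2_spec a :
  is_least (fun m => is_cardinal m /\
    forall l, is_cardinal l -> olt l a -> [set: set l] #<= [set: m])
    (weak_pow2 a).
Proof.
apply: leastP; have [m cm] := card_of_type (set a).
rewrite card_eq_le => /andP[_ am]; exists m; split=> // l _ /olt_card /card_leP[f].
apply: card_le_trans am; pose g (x : l) : a := sval (f (to_setT x)).
have gi : injective g.
  move=> x y /val_inj /(@inj _ _ _ f); rewrite !in_setT => /(_ isT isT).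
  by move/(congr1 sval).
apply: (@inj_le _ _ (fun A : set l => g @` A)) => A B AB.
have sub A' B' : g @` A' = g @` B' -> A' `<=` B'.
  by move=> e x A'x; have : (g @` B') (g x); [rewrite -e; exists x|case=> y + /gi <-].
by apply/seteqP; split; exact: sub.
Qed.

End WellDefined.

Section Borel.
Variable X : topologicalType.

(* The recursion defining g-Sigma^0_a(X), as an inductive predicate;
   [Sigma1E] and [SigmaE] are the two clauses of the recursion. *)
Inductive Sigma (g : Ord) : Ord -> set X -> Prop :=
| Sigma_open a U : oeq a (ofin 1) -> open U -> Sigma g a U
| Sigma_union a (d : Ord) (A : d -> set X) (b : d -> Ord) :
    olt (ofin 1) a -> olt d g ->
    (forall xi, olt (ofin 0) (b xi) /\ olt (b xi) a) ->
    (forall xi, Sigma g (b xi) (~` A xi)) ->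
    Sigma g a (\bigcup_xi A xi).

Definition Pi (g a : Ord) : set (set X) := [set ~` A | A in Sigma g a].

Definition Delta (g a : Ord) : set (set X) := Sigma g a `&` Pi g a.

Lemma Sigma1E g : Sigma g (ofin 1) = open.
Proof.
apply/funext => U; apply/propext; split; last exact/Sigma_open/oeq_refl.
move e: (ofin 1) => a h; case: h e => // {}a d A b a1 _ _ _ e.
by subst a; case: (olt_irr a1).
Qed.

Lemma SigmaE g a : olt (ofin 1) a ->
  Sigma g a = [set U | exists (d : Ord) (A : d -> set X),
    [/\ olt d g,
        forall xi, exists b, [/\ olt (ofin 0) b, olt b a & Pi g b (A xi)] &
        U = \bigcup_xi A xi]].
Proof.
move=> a1; apply/seteqP; split=> U /=.
  move=> h; case: h a1 => [{}a V a1 _ /olt_oeq /(_ a1) /olt_irr //|].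
  move=> {}a d A b _ dg bP SA _; exists d, A; split=> // xi; exists (b xi).
  by have [? ?] := bP xi; split=> //; exists (~` A xi) => //; rewrite setCK.
move=> [d [A [dg /choice[b bP] ->]]]; apply: (Sigma_union (b := b)) => // xi.
  by have [] := bP xi.
by have [_ _ [B SB <-]] := bP xi; rewrite setCK.
Qed.

Definition weight_le (k : Ord) : Prop :=
  exists2 B : set (set X), basis B & B #<= [set: k].

Definition additive (n : Ord) : Prop :=
  forall F : set (set X), F `<=` open -> F #< [set: n] ->
    open (\bigcap_(U in F) U).

End Borel.

Section Closure.
Variable T : Type.
Implicit Types C F : set (set T).

Definition closed_bigcup_le (k : Ord) C : Prop :=
  forall F, F `<=` C -> F #<= [set: k] -> C (\bigcup_(A in F) A).

Definition closed_bigcap_le (k : Ord) C : Prop :=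
  forall F, F `<=` C -> F #<= [set: k] -> C (\bigcap_(A in F) A).

Definition closed_bigcup_lt (k : Ord) C : Prop :=
  forall F, F `<=` C -> F #< [set: k] -> C (\bigcup_(A in F) A).

Definition closed_bigcap_lt (k : Ord) C : Prop :=
  forall F, F `<=` C -> F #< [set: k] -> C (\bigcap_(A in F) A).

Definition algebra (n : Ord) C : Prop :=
  (forall A, C A -> C (~` A)) /\
  forall (d : Ord) (A : d -> set T), olt d n -> (forall xi, C (A xi)) ->
    C (\bigcup_xi A xi).

End Closure.

(* Main.v *)
Require Import Defs.
From mathcomp Require Import all_boot.
From mathcomp Require Import boolp classical_sets functions cardinality.
From mathcomp Require Import topology.

Local Open Scope classical_set_scope.
Local Open Scope card_scope.

Set Implicit Arguments.
Unset Strict Implicit.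
Unset Printing Implicit Defensive.

(** Write [mu] for the cofinality of [k] and [S a], [P a] for the levels
    [Sigma] and [Pi] of index [1 + a].

    Two facts on cardinals drive the proof. First, [k] is a strong limit: if
    [2 ^ l] were [k] for some [l < k], then [k ^ mu] would be at most
    [2 ^ (mu * l) <= k], against Koenig's theorem ([small_set]). Hence [J ^ I]
    has size less than [k] as soon as [I] and [J] have ([small_fun]), so that
    an intersection over [I] of unions over [J] can be distributed into a union
    of fewer than [k] intersections ([bigcap_bigcup]). Secondly, [k] is a union
    of [mu < k] sets of size less than [k], so that every union of [k] sets is
    a union of [mu] unions of fewer than [k] sets ([small_fibers]).

    The induction on [a] carries, at the even levels, closure of [S a] under
    unions of size [k], together with the fact that for some fixed [J] of size
    less than [k] each set of [S a] is the union of a [J]-indexed family of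
    [P a] ([short_unions]). At level [0] the latter is the hypothesis on open
    sets, with [J = mu].

    If [a = b + 1] is odd, a set of [P a] is an intersection of fewer than [k]
    sets of [S b]; writing each of them as a [J]-union of sets of [P b] and
    distributing gives a union of fewer than [k] sets of [P b], as [P b] is
    closed under intersections of size [k] ([odd_compl]). So [S a = P a], and
    unions of length less than [mu] are harmless because a sum of fewer than
    [mu] cardinals below [k] is below [k] ([succ_cup_lt]).

    If [a] is even and nonzero, let [L] be the preceding level [S b = P b] when
    [a = b + 1], and the union of all lower levels when [a] is a limit; let [J]
    be [mu] or [cof a] accordingly. The point is that a union of [k] sets of
    [L] is already a union of [J]-many: when [a = b + 1] and [b = c + 1], it is
    a union of [k] sets of [P c], which are grouped into [mu] sets of [S b];
    when [a] is a limit, the sets are grouped according to a level in a cofinal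
    sequence of levels closed under unions of size [k]. Closure of [S a] under
    unions of size [k] follows, and closure under intersections is obtained
    once more by distributing ([even_step]). *)

(** * Comparing sizes by injections *)

Definition embeds (T U : Type) : Prop := exists f : T -> U, injective f.
Notation "T <~ U" := (embeds T U) (at level 70, no associativity).

Lemma embeds_refl T : T <~ T.
Proof. by exists id. Qed.

Lemma embeds_trans {T U V} : T <~ U -> U <~ V -> T <~ V.
Proof. by move=> [f fi] [g gi]; exists (g \o f); exact: inj_comp. Qed.

Lemma embeds_sig T (P : T -> Prop) : {x | P x} <~ T.
Proof. by exists sval; exact: sval_inj. Qed.

Lemma embeds_sub T U (f : T -> U) (P : T -> Prop) (Q : U -> Prop) :
  injective f -> (forall x, P x -> Q (f x)) -> {x | P x} <~ {y | Q y}.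
Proof.
move=> fi PQ; exists (fun u => exist Q (f (sval u)) (PQ _ (svalP u))) => u v.
by move=> /(congr1 sval) /= /fi /sval_inj.
Qed.

Lemma card_leT_embeds T U : [set: T] #<= [set: U] <-> T <~ U.
Proof.
split=> [/card_leP[f]|[f fi]].
  exists (fun x => sval (f (to_setT x))) => x y /val_inj /(@inj _ _ _ f).
  by rewrite !in_setT => /(_ isT isT) /(congr1 sval).
apply: card_le_trans (card_leT (f @` [set: T])).
have := @inj_card_eq _ _ [set: T] f (fun x y _ _ => @fi x y).
by rewrite card_eq_le => /andP[].
Qed.

Lemma card_eq_sig T (F : set T) : F #= [set: {x | F x}].
Proof.
have FE : F = sval @` [set: {x | F x}].
  by apply/seteqP; split=> [x Fx|_ [u _ <-]]; [exists (exist _ x Fx)|exact: svalP].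
have := @inj_card_eq _ _ setT (@sval T F) (fun u v _ _ => @sval_inj _ _ u v).
by rewrite -FE.
Qed.

Lemma card_le_embeds T (F : set T) U : F #<= [set: U] <-> {x | F x} <~ U.
Proof. by rewrite (card_le_eql (card_eq_sig F)); exact: card_leT_embeds. Qed.

Lemma card_eqT_embeds T U : [set: T] #= [set: U] <-> T <~ U /\ U <~ T.
Proof.
rewrite card_eq_le; split=> [/andP[/card_leT_embeds ? /card_leT_embeds ?] //|].
by move=> [/card_leT_embeds -> /card_leT_embeds ->].
Qed.

Lemma olt_embeds {a b} : olt a b -> a <~ b.
Proof. by move/olt_card/card_leT_embeds. Qed.

Lemma oeq_embeds {a b} : oeq a b -> a <~ b.
Proof. by move/oeq_card/card_eqT_embeds => []. Qed.

(** Both types are equinumerous with ordinals, and ordinals are comparable. *)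
Lemma embeds_total T U : T <~ U \/ U <~ T.
Proof.
have [a /card_eqT_embeds[aT Ta]] := ord_of_type T.
have [b /card_eqT_embeds[bU Ub]] := ord_of_type U.
case: (olt_total a b) => [/olt_embeds|/oeq_embeds|/olt_embeds] h.
- by left; apply: embeds_trans Ta (embeds_trans h bU).
- by left; apply: embeds_trans Ta (embeds_trans h bU).
- by right; apply: embeds_trans Ub (embeds_trans h aT).
Qed.

Lemma card_lt_embeds T (F : set T) U :
  F #< [set: U] <-> ~ U <~ {x | F x}.
Proof.
rewrite /card_lt (card_le_eqr (card_eq_sig F)); split.
  by move=> /andP[_ /negP FU] /card_leT_embeds.
move=> FU; apply/andP; split; last by apply/negP => /card_leT_embeds.
by apply/card_le_embeds; case: (embeds_total {x | F x} U).
Qed.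

Lemma embeds_surj T U (t0 : T) :
  T <~ U -> exists g : U -> T, forall t, exists u, g u = t.
Proof.
move=> [e ei]; exists (fun u => if pselect (exists t, e t = u) is left ex
  then projT1 (cid ex) else t0) => t; exists (e t).
by case: pselect => [ex|[]]; [case: (cid ex) => t' /= /ei|exists t].
Qed.

Lemma embeds_prod {T T' U U'} :
  T <~ T' -> U <~ U' -> (T * U)%type <~ (T' * U')%type.
Proof.
move=> [f fi] [g gi]; exists (fun p => (f p.1, g p.2)) => -[x y] [x' y'] /=.
by case=> /fi -> /gi ->.
Qed.

Lemma embeds_sum {T W W'} {I : T -> Type} :
  T <~ W -> (forall t, I t <~ W') -> {t : T & I t} <~ (W * W')%type.
Proof.
move=> [f fi] h; pose g t := projT1 (cid (h t)).
have gi t : injective (g t) by exact: projT2 (cid (h t)).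
exists (fun s => (f (projT1 s), g _ (projT2 s))) => -[t i] [t' i'] /= [/fi e].
by case: _ / e i' => i' /gi ->.
Qed.

Lemma embeds_set {T U} : T <~ U -> set T <~ set U.
Proof.
move=> [f fi]; exists (fun A => f @` A) => A B AB.
have sub A' B' : f @` A' = f @` B' -> A' `<=` B'.
  move=> e x A'x; have : (f @` B') (f x) by rewrite -e; exists x.
  by case=> y + /fi <-.
by apply/seteqP; split; exact: sub.
Qed.

(** A function is determined by its graph. *)
Lemma embeds_fun T U W : U <~ set W -> (T -> U) <~ set (T * W).
Proof.
move=> [e ei]; exists (fun h => [set p | e (h p.1) p.2]) => h h' hh'.
apply/funext => t; apply: ei; apply/funext => w.
exact: (congr1 (fun A : set (T * W) => A (t, w)) hh').
Qed.

Lemma embeds_set1 T : T <~ set T.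
Proof.
exists set1 => x y e.
by have : [set x] x by []; rewrite e.
Qed.

(** * Infinite cardinals *)

Definition ord_le (a : Ord) (x y : a) : Prop := ord_lt x y \/ x = y.

Lemma ord_le_trans (a : Ord) (x y z : a) :
  ord_le x y -> ord_le y z -> ord_le x z.
Proof. by move=> [xy|->] // [yz|<-]; left=> //; exact: ord_trans yz. Qed.

Section Cardinal.
Variable k : Ord.
Hypothesis k_card : is_cardinal k.

Lemma cardinal_olt {a} : olt a k -> ~ k <~ a.
Proof.
move=> ak ka; have /negP := k_card ak; apply.
by apply/card_eqT_embeds; split=> //; exact: olt_embeds.
Qed.

Lemma small_seg (x : k) : ~ k <~ seg x.
Proof. exact: cardinal_olt (seg_olt x). Qed.

Lemma small_embeds {T} : ~ k <~ T -> T <~ k.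
Proof. by case: (embeds_total T k). Qed.

Lemma small_olt {T} : ~ k <~ T ->
  exists2 a, olt a k & is_cardinal a /\ (T <~ a /\ a <~ T).
Proof.
move=> kT; have [a ca /card_eqT_embeds[aT Ta]] := card_of_type T.
exists a => //; case: (olt_total a k) => // h; case: kT.
  exact: embeds_trans (oeq_embeds (oeq_sym h)) aT.
exact: embeds_trans (olt_embeds h) aT.
Qed.

(** Sizes below [k] are bounded by proper initial segments; this turns a family
    of sizes into a family of elements of [k], to which cofinality applies. *)
Lemma small_embeds_seg {T} : ~ k <~ T -> exists x : k, T <~ seg x.
Proof.
move=> /small_olt[a [x ax] [_ [Ta _]]]; exists x.
exact: embeds_trans Ta (oeq_embeds ax).
Qed.

Hypothesis k_inf : nat <~ k.

(** Hilbert's hotel. *)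
Lemma embeds_option T : nat <~ T -> option T <~ T.
Proof.
move=> [f fi].
pose g (x : T) : T := if pselect (exists n, x = f n) is left ex
  then f (projT1 (cid ex)).+1 else x.
have gf n : g (f n) = f n.+1.
  rewrite /g; case: pselect => [ex|[]]; last by exists n.
  by case: (cid ex) => m /= /fi ->.
have gN x : ~ (exists n, x = f n) -> g x = x by rewrite /g; case: pselect.
exists (fun o => if o is Some x then g x else f 0) => -[x|] [y|] //=.
- case: (pselect (exists n, x = f n)) => [[n ->]|nx];
    case: (pselect (exists n, y = f n)) => [[m ->]|ny]; rewrite ?gf ?gN //.
  + by move=> /fi[->].
  + by move=> e; case: ny; exists n.+1.
  + by move=> e; case: nx; exists m.+1.
  + by move=> ->.
- case: (pselect (exists n, x = f n)) => [[n ->]|nx]; rewrite ?gf ?gN //.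
    by move=> /fi.
  by move=> e; case: nx; exists 0.
- case: (pselect (exists n, y = f n)) => [[n ->]|nx]; rewrite ?gf ?gN //.
    by move=> /fi.
  by move=> e; case: nx; exists 0.
Qed.

Lemma nat_embedsN T : ~ nat <~ T -> finite_set [set: T].
Proof. by move=> h; apply/finite_setPn => /card_leT_embeds. Qed.

(** Including [x] adds one point to the segment below [x], which matters only
    to finite sizes. *)
Lemma small_le (x : k) : ~ k <~ {y | ord_le y x}.
Proof.
have e : {y | ord_le y x} <~ option (seg x).
  pose f (u : {y | ord_le y x}) : option (seg x) :=
    if pselect (ord_lt (sval u) x) is left h then Some (in_seg h) else None.
  exists f => -[u hu] [v hv]; rewrite /f /=.
  case: pselect => [a|a]; case: pselect => [b|b] // e; apply: sval_inj => /=.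
    by case: e.
  by case: hu => // ->; case: hv.
move=> /embeds_trans/(_ e) h.
case: (pselect (nat <~ seg x)) => [/embeds_option h'|/nat_embedsN fin].
  exact: small_seg (embeds_trans h h').
have /card_leT_embeds := embeds_trans k_inf h.
apply/finite_setPn.
have -> : [set: option (seg x)] = [set None] `|` Some @` [set: seg x].
  by apply/seteqP; split=> // -[u|] _; [right; exists u|left].
by rewrite finite_setU; split; [exact: finite_set1|exact: finite_image].
Qed.

Lemma small_finite {T} : finite_set [set: T] -> ~ k <~ T.
Proof.
move=> fin kT; have /card_leT_embeds := embeds_trans k_inf kT.
exact/finite_setPn.
Qed.

End Cardinal.

(** The lexicographic order of [a * b] on the range of [f]. Passing through an
    injection allows [hessenberg] to adjoin the maximum of a pair as a first
    coordinate. *)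
Section Lex.
Variables (a b : Ord) (T : Type) (f : T -> a * b).
Hypothesis fi : injective f.

Definition lex_lt (u v : T) : Prop :=
  ord_lt (f u).1 (f v).1 \/ (f u).1 = (f v).1 /\ ord_lt (f u).2 (f v).2.

Lemma lex_wf : well_founded lex_lt.
Proof.
suff H x y u : f u = (x, y) -> Acc lex_lt u by move=> u; case E: (f u); exact: H E.
elim/(well_founded_ind (@ord_wf a)): x y u => x IHx y.
elim/(well_founded_ind (@ord_wf b)): y => y IHy u fu.
constructor=> v; rewrite /lex_lt fu /=; case E: (f v) => [x' y'] /=.
by case=> [/IHx|[e /IHy]]; apply; [exact: E|rewrite E e].
Qed.

Lemma lex_trans u v w : lex_lt u v -> lex_lt v w -> lex_lt u w.
Proof.
rewrite /lex_lt => -[h|[h h']] [g|[g g']].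
- by left; exact: ord_trans g.
- by left; rewrite -g.
- by left; rewrite h.
- by right; rewrite h; split=> //; exact: ord_trans g'.
Qed.

Lemma lex_total u v : [\/ lex_lt u v, u = v | lex_lt v u].
Proof.
rewrite /lex_lt; case: (ord_total (f u).1 (f v).1) => h.
- by constructor 1; left.
- case: (ord_total (f u).2 (f v).2) => h'.
  + by constructor 1; right.
  + constructor 2; apply: fi; move: h h'.
    by case: (f u) => ? ?; case: (f v) => ? ? /= -> ->.
  + by constructor 3; right.
- by constructor 3; left.
Qed.

Definition lex : Ord := MkOrd lex_wf lex_trans lex_total.
End Lex.

Definition omax (k : Ord) (x y : k) : k :=
  if pselect (ord_lt x y) then y else x.

Lemma omax_ge (k : Ord) (x y : k) : let m := omax x y in
  ord_le x m /\ ord_le y m.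
Proof.
rewrite /= /omax; case: pselect => h; split; [by left|by right|by right|].
by case: (ord_total x y) => // h'; [right|left].
Qed.

(** The square of a type of size less than [k], granting that infinite
    cardinals below [k] are equal to their squares: stated in this form to serve
    both inside the induction of [hessenberg] and after it. *)
Lemma small_square (k : Ord) W : is_cardinal k -> nat <~ k ->
  (forall a, olt a k -> is_cardinal a -> nat <~ a -> (a * a)%type <~ a) ->
  ~ k <~ W -> ~ k <~ (W * W)%type.
Proof.
move=> kc kinf IH Wk kWW.
case: (pselect (nat <~ W)) => [Winf|/nat_embedsN Wfin]; last first.
  apply: (@small_finite k kinf (W * W)%type _ kWW).
  have -> : [set: W * W] = [set: W] `*` [set: W] by apply/seteqP.
  exact: finite_setX.
have [a ak [ac [Wa aW]]] := small_olt Wk; apply: Wk.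
apply: embeds_trans kWW _; apply: embeds_trans (embeds_prod Wa Wa) _.
exact: embeds_trans (IH a ak ac (embeds_trans Winf Wa)) aW.
Qed.

(** Goedel's well-order of [k * k], by maximum first: the pairs below a given
    one lie in the square of the set of elements up to its maximum, which by
    induction has size less than [k], so that the order type is at most [k]. *)
Lemma hessenberg (k : Ord) : is_cardinal k -> nat <~ k -> (k * k)%type <~ k.
Proof.
elim/(well_founded_ind olt_wf): k => k IH kc kinf.
pose f (p : k * k) : k * lex (inj_id (A := k * k)) := (omax p.1 p.2, p).
have fi : injective f by move=> p q [].
suff : ~ olt k (lex fi).
  move=> h; case: (olt_total (lex fi) k) => // [/olt_embeds|/oeq_embeds] //.
move=> [p kp]; have := @small_le k kc kinf (omax p.1 p.2).
move=> /(small_square kc kinf IH); set W := (sig _); apply.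
have seg_W : seg p <~ (W * W)%type.
  have h (q : k * k) : lex_lt f q p ->
      ord_le q.1 (omax p.1 p.2) /\ ord_le q.2 (omax p.1 p.2).
    move=> qp; have [h1 h2] := omax_ge q.1 q.2.
    have {}qp : ord_le (omax q.1 q.2) (omax p.1 p.2).
      by case: qp => [|[]]; [left|right].
    by split; [exact: ord_le_trans h1 qp|exact: ord_le_trans h2 qp].
  pose w y h : W := exist _ y h.
  exists (fun q : seg p => (w _ (h _ (svalP q)).1, w _ (h _ (svalP q)).2)).
  move=> [[q1 q2] hq] [[r1 r2] hr] [e1 e2]; apply: sval_inj => /=.
  by rewrite /= in e1 e2; rewrite e1 e2.
exact: embeds_trans (oeq_embeds kp) seg_W.
Qed.

(** * Cofinalities *)

Definition cofinal_in (a : Ord) (T : Type) : Prop :=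
  exists f : T -> a, forall x, exists t, ord_le x (f t).

Lemma ord_lt_irr (a : Ord) (x : a) : ~ ord_lt x x.
Proof. by move/olt_seg/olt_irr. Qed.

(** The point [x0] makes [T] inhabited, so that an injection of [T] into [U]
    yields a surjection of [U] onto [T]. *)
Lemma cofinal_embeds (a : Ord) (x0 : a) T U :
  T <~ U -> cofinal_in a T -> cofinal_in a U.
Proof.
move=> TU [f fc]; have [t0 _] := fc x0; have [g gs] := embeds_surj t0 TU.
exists (f \o g) => x; have [t ht] := fc x; have [u ut] := gs t.
by exists u => /=; rewrite ut.
Qed.

Lemma cofinal_inE (a b : Ord) :
  cofinal_in a b <-> exists f : b -> a, cofinal_map f.
Proof.
by split=> -[f fc]; exists f => x; have [t [h|h]] := fc x; exists t;
  [right|left|right|left].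
Qed.

Lemma cof_cofinal (a : Ord) : cofinal_in a (cof a).
Proof. by have [/cofinal_inE] := cof_spec a. Qed.

Lemma cof_embeds (a : Ord) : cof a <~ a.
Proof.
have [_ lst] := cof_spec a.
case: (olt_total (cof a) a) => [/olt_embeds|/oeq_embeds|/lst] //.
by case; exists id => x; exists x; left.
Qed.

(** The least length of a cofinal sequence is also the least size of a cofinal
    family: an unordered family can be indexed by an ordinal of the same size. *)
Lemma cof_le_cofinal (a : Ord) T : cofinal_in a T -> cof a <~ T.
Proof.
case: (pselect (exists x0 : a, True)) => [[x0 _] Tc|na _]; last first.
  apply: embeds_trans (cof_embeds a) _.
  have F (x : a) : False by apply: na; exists x.
  by exists (fun x => False_rect T (F x)) => x; case: (F x).
have [d /card_eqT_embeds[dT Td]] := ord_of_type T.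
have dc := cofinal_embeds x0 Td Tc.
have [_ lst] := cof_spec a; apply: embeds_trans dT.
case: (olt_total (cof a) d) => [/olt_embeds|/oeq_embeds|/lst] //.
by case; exact/cofinal_inE.
Qed.

Lemma cof_bounded (a : Ord) T (f : T -> a) :
  ~ cof a <~ T -> exists x, forall t, ord_lt (f t) x.
Proof.
move=> aT; apply: contrapT => nb; apply/aT/cof_le_cofinal; exists f => x.
apply: contrapT => nx; apply: nb; exists x => t.
case: (ord_total (f t) x) => // h; case: nx; exists t; [by right|by left].
Qed.

Lemma cof_cardinal (a : Ord) : is_cardinal (cof a).
Proof.
move=> b bc; apply/negP => /card_eqT_embeds[_ cb].
have [_ lst] := cof_spec a; apply: (lst b bc).
have [y _] := bc; have [f _] := cof_cofinal a.
exact/cofinal_inE/(cofinal_embeds (f y) cb)/cof_cofinal.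
Qed.

(** The cardinal of [a] is below the successor of [k], hence not above [k]. *)
Lemma olt_succ_card (k a : Ord) : olt a (succ_card k) -> a <~ k.
Proof.
move=> ak; have [[sc ksc] lst] := succ_card_spec k.
have [b bc /card_eqT_embeds[ba ab]] := card_of_type a.
have : olt b (succ_card k).
  case: (olt_total b (succ_card k)) => // h; case: (cardinal_olt sc ak).
    exact: embeds_trans (oeq_embeds (oeq_sym h)) ba.
  exact: embeds_trans (olt_embeds h) ba.
move=> /lst kb; apply: embeds_trans ab _.
case: (olt_total b k) => [/olt_embeds|/oeq_embeds|h] //.
by case: kb.
Qed.

(** * Singular cardinals [k] with [2 ^ (< k) = k] *)

Section Singular.
Variable k : Ord.
Hypothesis k_singular : singular k.
Hypothesis k_pow : oeq (weak_pow2 k) k.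

Notation small T := (~ k <~ T).

Let k_card : is_cardinal k. Proof. by case: k_singular. Qed.

Let k_inf : nat <~ k. Proof. by case: k_singular => _ /olt_embeds. Qed.

Lemma small_cof : small (cof k).
Proof. by case: k_singular => _ _; exact: cardinal_olt. Qed.

Lemma small_sub T U : U <~ T -> small T -> small U.
Proof. by move=> UT kT kU; apply: kT; exact: embeds_trans UT. Qed.

Lemma small_cof_lt T : ~ cof k <~ T -> small T.
Proof. by move=> h kT; apply: h; exact: embeds_trans (cof_embeds k) kT. Qed.

Lemma square_embeds : (k * k)%type <~ k.
Proof. exact: hessenberg. Qed.

Lemma small_prod T U : small T -> small U -> small (T * U)%type.
Proof.
move=> /small_embeds_seg[x Tx] /small_embeds_seg[y Uy].
pose W := {z | ord_le z (omax x y)}.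
have [hx hy] := omax_ge x y.
have seg_W z : ord_le z (omax x y) -> seg z <~ W.
  move=> h; apply: (@embeds_sub _ _ id) => [|w wz]; first exact: inj_id.
  by apply: ord_le_trans h; left.
apply: small_sub (embeds_prod (embeds_trans Tx (seg_W _ hx))
  (embeds_trans Uy (seg_W _ hy))) _.
apply: (small_square k_card k_inf (fun a _ => @hessenberg a)).
exact: small_le.
Qed.

Lemma sum_embeds T (I : T -> Type) :
  T <~ k -> (forall t, I t <~ k) -> {t : T & I t} <~ k.
Proof. by move=> Tk Ik; apply: embeds_trans (embeds_sum Tk Ik) square_embeds. Qed.

(** The sizes of fewer than [cof k] small types are bounded by a common segment
    of [k], so that the sum embeds in a product of two small types. *)
Lemma small_sum T (I : T -> Type) :
  ~ cof k <~ T -> (forall t, small (I t)) -> small {t : T & I t}.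
Proof.
move=> cT Is.
have [f hf] := choice (fun t => small_embeds_seg (Is t)).
have [x fx] := cof_bounded f cT.
apply: small_sub (small_prod (small_cof_lt cT) (@small_seg k k_card x)).
apply: embeds_sum => [|t]; first exact: embeds_refl.
exact: embeds_trans (hf t) (olt_embeds (olt_seg (fx t))).
Qed.

(** [k] is the union of the segments up to the terms of a cofinal sequence. *)
Lemma small_fibers T : T <~ k ->
  exists h : T -> cof k, forall i, small {t | h t = i}.
Proof.
move=> [e ei]; have [c cc] := cof_cofinal k.
have [h hP] := choice (fun t => cc (e t)).
exists h => i; apply: small_sub (@small_le k k_card k_inf (c i)).
by apply: (embeds_sub ei) => t <-.
Qed.

(** This is all that [2 ^ (< k) = k] says; strictness is [small_set]. *)
Lemma set_embeds T : small T -> set T <~ k.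
Proof.
move=> /small_olt[a ak [ac [Ta _]]].
have [[_ h] _] := weak_pow2_spec k.
apply: embeds_trans (embeds_set Ta) _; apply: embeds_trans (oeq_embeds k_pow).
by apply/card_leT_embeds; exact: h.
Qed.

(** Koenig's theorem: otherwise some diagonal function [h] avoids, at a place
    [i] with [x <= c i], the value of the [x]-th function. *)
Lemma koenig : ~ (cof k -> k) <~ k.
Proof.
move=> [e ei]; have [c cc] := cof_cofinal k.
have avoid i : exists y : k, forall g, ord_le (e g) (c i) -> g i <> y.
  apply: contrapT => /forallNP av.
  have {}av y : exists g : cof k -> k, ord_le (e g) (c i) /\ g i = y.
    by apply: contrapT => /forallNP h; apply: (av y) => g hg gy; exact: (h g).
  have [g gP] := choice av.
  apply: (@small_le k k_card k_inf (c i)).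
  exists (fun y => exist (@ord_le k ^~ (c i)) _ (gP y).1) => y z [/ei gyz].
  by rewrite -(gP y).2 gyz (gP z).2.
have [h hP] := choice avoid; have [i hi] := cc (e h).
exact: (hP i h).
Qed.

(** [k] is a strong limit: if [k <= 2 ^ |T|] with [T] small, then
    [k ^ cof k <= 2 ^ (cof k * |T|) <= k], against Koenig's theorem. *)
Lemma small_set T : small T -> small (set T).
Proof.
move=> Ts kT; apply: koenig; apply: embeds_trans (embeds_fun _ kT) _.
exact/set_embeds/small_prod/Ts/small_cof.
Qed.

Lemma small_fun T U : small T -> small U -> small (T -> U).
Proof.
move=> Ts Us; apply: small_sub (embeds_fun _ (embeds_set1 U)) _.
exact/small_set/small_prod.
Qed.

(** The cofinality of an ordinal of size at most [k] is a regular cardinal at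
    most [k], hence is not the singular [k] itself. *)
Lemma small_cof_le (a : Ord) : a <~ k -> small (cof a).
Proof.
move=> [e ei] ka; have [c cc] := cof_cofinal k.
pose T i := {x : a | ord_le (e x) (c i)}.
have Ts i : ~ cof a <~ T i.
  move=> aT; apply: (@small_le k k_card k_inf (c i)).
  apply: embeds_trans ka (embeds_trans aT _).
  exact: (embeds_sub ei).
have [g gP] := choice (fun i => cof_bounded (fun u : T i => sval u) (@Ts i)).
have [|x gx] := @cof_bounded a (cof k) g.
  by move=> h; apply: small_cof; exact: embeds_trans ka h.
have [i xi] := cc (e x).
exact: ord_lt_irr (ord_trans (gP i (exist _ x xi)) (gx i)).
Qed.

End Singular.

(** * Ordinal arithmetic *)

(** An ordinal is determined by the ordinals below it; together with [olt_add]
    this reduces identities between sums to comparing what lies below them. *)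
Lemma olt_ext (a b : Ord) : (forall c, olt c a <-> olt c b) -> oeq a b.
Proof. by move=> h; case: (olt_total a b) => // /h /olt_irr. Qed.

Lemma oeq_oltr (a b c : Ord) : oeq a b -> olt c a <-> olt c b.
Proof. by move=> ab; split=> /olt_oeq; apply=> //; exact: oeq_sym. Qed.

(** Totality makes a strictly increasing surjection an isomorphism. *)
Lemma mono_surj_oeq (a b : Ord) (f : a -> b) :
  (forall x y, ord_lt x y -> ord_lt (f x) (f y)) ->
  (forall y, exists x, f x = y) -> oeq a b.
Proof.
move=> fm /choice[g gK]; have fi : injective f.
  move=> x y e; case: (ord_total x y) => // /fm; rewrite e => /ord_lt_irr //.
exists f; split; first by exists g => // x; apply: fi; rewrite gK.
move=> x y; split; first exact: fm.
case: (ord_total x y) => // [->|/fm h h']; first by move/ord_lt_irr.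
by have /ord_lt_irr := ord_trans h h'.
Qed.

Lemma nolt0 (a : Ord) : ~ olt a (ofin 0).
Proof. by move=> [[]]. Qed.

Lemma olt0 (a : Ord) : ~ oeq a (ofin 0) -> olt (ofin 0) a.
Proof. by case: (olt_total a (ofin 0)) => // /nolt0. Qed.

Lemma seg_inl (a b : Ord) (x : a) : oeq (seg (inl x : oadd a b)) (seg x).
Proof.
apply: oeq_sym; apply: (@mono_surj_oeq (seg x) (seg (inl x : oadd a b))
  (fun u => @in_seg (oadd a b) (inl x) (inl (sval u)) (svalP u))) => //.
by move=> [[y|y] h] //; exists (@in_seg a x y h); exact: sval_inj.
Qed.

Lemma seg_inr (a b : Ord) (y : b) :
  oeq (seg (inr y : oadd a b)) (oadd a (seg y)).
Proof.
apply: oeq_sym; apply: (@mono_surj_oeq (oadd a (seg y)) (seg (inr y : oadd a b))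
  (fun u => match u with
    | inl x => @in_seg (oadd a b) (inr y) (inl x) I
    | inr v => @in_seg (oadd a b) (inr y) (inr (sval v)) (svalP v) end)).
  by move=> [x|v] [x'|v'].
move=> [[x|z] h]; [exists (inl x)|exists (inr (@in_seg b y z h))]; exact: sval_inj.
Qed.

Lemma oadd_oeqr (a b b' : Ord) : oeq b b' -> oeq (oadd a b) (oadd a b').
Proof.
move=> [f [[g fK gK] fm]].
apply: (@mono_surj_oeq (oadd a b) (oadd a b')
  (fun u => match u with inl x => inl x | inr y => inr (f y) end)).
  by move=> [x|y] [x'|y'] //= /fm.
by move=> [x|y]; [exists (inl x)|exists (inr (g y)); rewrite gK].
Qed.

Lemma olt_add (a b c : Ord) :
  olt c (oadd a b) <-> olt c a \/ exists y : b, oeq c (oadd a (seg y)).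
Proof.
split=> [[[x|y] h]|[[x h]|[y h]]].
- by left; exists x; exact: oeq_trans h (seg_inl _ _).
- by right; exists y; exact: oeq_trans h (seg_inr _ _).
- by exists (inl x); exact: oeq_trans h (oeq_sym (seg_inl _ _)).
- by exists (inr y); exact: oeq_trans h (oeq_sym (seg_inr _ _)).
Qed.

Lemma seg_ofin n (i : ofin n) : oeq (seg i) (ofin (i : 'I_n)).
Proof.
apply: (@mono_surj_oeq (seg i) (ofin (i : 'I_n))
  (fun u => Ordinal (svalP u : (sval u < i)%N))) => // -[m mi].
exists (@in_seg (ofin n) i (Ordinal (ltn_trans mi (ltn_ord i))) mi).
exact: val_inj.
Qed.

Lemma olt_addn (a c : Ord) n : olt c (oadd a (ofin n)) <->
  olt c a \/ exists2 m, (m < n)%N & oeq c (oadd a (ofin m)).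
Proof.
rewrite olt_add; split=> -[h|]; try by left.
  move=> [i h]; right; exists (i : 'I_n); first exact: ltn_ord.
  exact: oeq_trans h (oadd_oeqr _ (seg_ofin i)).
move=> [m mn h]; right; exists (Ordinal mn : ofin n).
exact: oeq_trans h (oeq_sym (oadd_oeqr _ (seg_ofin (Ordinal mn : ofin n)))).
Qed.

Lemma oadd0 (a : Ord) : oeq (oadd a (ofin 0)) a.
Proof.
by apply: olt_ext => c; rewrite olt_addn; split=> [[|[]]|] //; left.
Qed.

Notation osucc a := (oadd a (ofin 1)).

Lemma olt_succ (a c : Ord) : olt c (osucc a) <-> olt c a \/ oeq c a.
Proof.
rewrite olt_addn; split=> -[h|]; try by left.
  by move=> [[]// _ h]; right; exact: oeq_trans h (oadd0 a).
by move=> h; right; exists 0 => //; apply: oeq_trans h (oeq_sym (oadd0 a)).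
Qed.

Lemma olt_succr (a : Ord) : olt a (osucc a).
Proof. by apply/olt_succ; right; exact: oeq_refl. Qed.

Lemma oaddS (a : Ord) n : oeq (oadd a (ofin n.+1)) (osucc (oadd a (ofin n))).
Proof.
apply: olt_ext => c; rewrite olt_succ !olt_addn; split=> [[h|[m]]|[[h|[m mn h]]|h]].
- by left; left.
- rewrite ltnS leq_eqVlt => /predU1P[->|mn] h; [by right|].
  by left; right; exists m.
- by left.
- by right; exists m => //; exact: ltnW.
- by right; exists n.
Qed.

Lemma succ_oeq (a b : Ord) : oeq a b -> oeq (osucc a) (osucc b).
Proof.
move=> ab; apply: olt_ext => c; rewrite !olt_succ (oeq_oltr c ab).
split=> -[h|h]; [by left|right|by left|right]; apply: oeq_trans h _ => //.
exact: oeq_sym.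
Qed.

Lemma limit_oeq (a b : Ord) : oeq a b -> is_limit a -> is_limit b.
Proof.
move=> ab [a0 aS]; split=> [b0|[c bc]]; first exact/a0/(oeq_trans ab).
by apply: aS; exists c; exact: oeq_trans bc.
Qed.

Lemma limit_succ (a b : Ord) : is_limit a -> olt b a -> olt (osucc b) a.
Proof.
move=> [_ aS] ba; case: (olt_total (osucc b) a) => // [h|].
  by case: aS; exists b; exact: oeq_sym.
move=> /olt_succ[ab|ab]; first by case: (olt_irr (olt_trans ab ba)).
by case: (olt_irr (oeq_olt ab ba)).
Qed.

Lemma even_succ (a b : Ord) : is_even b -> oeq a (osucc b) -> is_odd a.
Proof.
move=> [l [n [[ll bln] n2]]] ab; exists l, n.+1; split=> //; split=> //.
exact: oeq_trans ab (oeq_trans (succ_oeq bln) (oeq_sym (oaddS _ _))).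
Qed.

Lemma odd_succ (a b : Ord) : is_odd b -> oeq a (osucc b) -> is_even a.
Proof.
move=> [l [n [[ll bln] n2]]] ab; exists l, n.+1; split; last by rewrite /= negbK.
split=> //; exact: oeq_trans ab (oeq_trans (succ_oeq bln) (oeq_sym (oaddS _ _))).
Qed.

Lemma even_cases (a : Ord) : is_even a ->
  [\/ oeq a (ofin 0), is_limit a | exists2 b, is_odd b & oeq a (osucc b)].
Proof.
move=> [l [[|n] [[ll aln] n2]]].
  have la := oeq_sym (oeq_trans aln (oadd0 l)).
  case: ll => [l0|ll]; first by constructor 1; exact: oeq_trans (oeq_sym la) l0.
  by constructor 2; exact: limit_oeq la ll.
constructor 3; exists (oadd l (ofin n)); last exact: oeq_trans aln (oaddS _ _).
exists l, n; split; last by move: n2; rewrite /= negbK.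
by split=> //; exact: oeq_refl.
Qed.

Lemma odd_cases (a : Ord) : is_odd a -> exists2 b, is_even b & oeq a (osucc b).
Proof.
move=> [l [[|n] [[ll aln] n2]]] //.
exists (oadd l (ofin n)); last exact: oeq_trans aln (oaddS _ _).
by exists l, n; split=> //; split=> //; exact: oeq_refl.
Qed.

Lemma parity_total (a : Ord) : is_even a \/ is_odd a.
Proof.
elim/(well_founded_ind olt_wf): a => a IH.
case: (pselect (oeq a (ofin 0))) => [a0|a0].
  left; exists a, 0; split=> //; split; [by left|exact/oeq_sym/oadd0].
case: (pselect (exists b, oeq a (osucc b))) => [[b ab]|aS]; last first.
  by left; exists a, 0; split=> //; split; [by right|exact/oeq_sym/oadd0].
case: (IH b) => [|bE|bO]; first exact: olt_oeq (olt_succr b) (oeq_sym ab).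
  by right; exact: even_succ bE ab.
by left; exact: odd_succ bO ab.
Qed.

(** One of [b + 1] and [b + 2] is even. *)
Lemma limit_even (a b : Ord) : is_limit a -> olt b a ->
  exists c, [/\ is_even c, olt b c & olt c a].
Proof.
move=> la /(limit_succ la) ba; case: (parity_total (osucc b)) => [bE|bO].
  by exists (osucc b); split=> //; exact: olt_succr.
exists (osucc (osucc b)); split; last exact: limit_succ.
- exact: odd_succ bO (oeq_refl _).
- exact: olt_trans (olt_succr _) (olt_succr _).
Qed.

Notation oneadd a := (oadd (ofin 1) a).

Lemma olt_oneadd (a b : Ord) : olt b a -> olt (oneadd b) (oneadd a).
Proof. by move=> [y by_]; apply/olt_add; right; exists y; exact: oadd_oeqr. Qed.

Lemma olt0_oneadd (a : Ord) : olt (ofin 0) (oneadd a).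
Proof. by apply: olt0 => -[f _]; case: (f (inl ord0)). Qed.

Lemma olt1_oneadd (a : Ord) : olt (ofin 0) a -> olt (ofin 1) (oneadd a).
Proof. by move/olt_oneadd; apply: oeq_olt; exact/oeq_sym/oadd0. Qed.

Lemma olt_oneadd_inv (a c : Ord) : olt c (oneadd a) -> olt (ofin 0) c ->
  exists2 b, olt b a & oeq c (oneadd b).
Proof.
move=> /olt_add[[i ci] /olt_oeq/(_ ci)[u _]|[y cy] _]; last first.
  by exists (seg y) => //; exact: seg_olt.
by have := svalP u; case: (sval u) => -[|m] //= hm; case: i {ci u} => -[|m'].
Qed.

(** * Closure properties of the hierarchy *)

Section Hierarchy.
Variables (k : Ord) (X : topologicalType).
Hypothesis k_singular : singular k.
Hypothesis k_pow : oeq (weak_pow2 k) k.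
Hypothesis X_open : forall U : set X, open U ->
  exists F : set (set X),
    [/\ F #<= [set: cof k], F `<=` closed & U = \bigcup_(C in F) C].

Notation small T := (~ k <~ T).

(** The shift by [1] makes every ordinal the index of a level, the open sets
    being level [0]. *)
Definition Sigma1p (a : Ord) (U : set X) : Prop := Sigma k (oneadd a) U.

Lemma Sigma_oeq (g a b : Ord) (U : set X) :
  oeq a b -> Sigma g a U -> Sigma g b U.
Proof.
move=> ab Sa; case: Sa ab => [{}a V a1 oV|{}a d A c a1 dg cP SA] ab.
  by apply: Sigma_open => //; exact: oeq_trans (oeq_sym ab) a1.
apply: (@Sigma_union _ _ _ d A c) => // [|i]; first exact: olt_oeq ab.
by have [? ?] := cP i; split=> //; exact: olt_oeq ab.
Qed.

Lemma PiE (g a : Ord) (U : set X) : Pi g a U <-> Sigma g a (~` U).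
Proof.
split=> [[V SV <-]|SU]; first by rewrite setCK.
by exists (~` U) => //; rewrite setCK.
Qed.

Lemma Sigma1p_oeq (a b : Ord) U : oeq a b -> Sigma1p a U -> Sigma1p b U.
Proof. by move=> ab; apply: Sigma_oeq; exact: oadd_oeqr. Qed.

Lemma Sigma1p_open (a : Ord) U : oeq a (ofin 0) -> Sigma1p a U <-> open U.
Proof.
move=> a0; rewrite -(Sigma1E X k).
have a1 := oeq_trans (oadd_oeqr (ofin 1) a0) (oadd0 _).
by split; apply: Sigma_oeq => //; exact: oeq_sym.
Qed.

Lemma cardinal_k : is_cardinal k. Proof. by case: k_singular. Qed.

Lemma nat_k : nat <~ k. Proof. by case: k_singular => _ /olt_embeds. Qed.

(** The recursive clause, with the length [d < k] replaced by any index type of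
    size less than [k], and the levels [1 <= c < 1 + a] written as [1 + b] with
    [b < a]. *)
Lemma Sigma1p_union (a : Ord) U : olt (ofin 0) a -> Sigma1p a U <->
  exists (I : Type) (A : I -> set X), [/\ small I,
    forall i, exists2 b, olt b a & Sigma1p b (~` A i) & U = \bigcup_i A i].
Proof.
move=> a0; rewrite /Sigma1p SigmaE; last exact: olt1_oneadd.
split=> /= [[d [A [dk AP ->]]]|[I [A [Ik AP ->]]]].
  exists d, A; split=> // [|i]; first exact: (cardinal_olt cardinal_k dk).
  have [b [b0 ba /PiE SA]] := AP i.
  have [c ca bc] := olt_oneadd_inv ba b0.
  by exists c => //; exact: Sigma_oeq bc SA.
have AP' i : exists b, [/\ olt (ofin 0) b, olt b (oneadd a) & Pi k b (A i)].
  have [b ba SA] := AP i; exists (oneadd b); split; last exact/PiE.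
    exact: olt0_oneadd.
  exact: olt_oneadd.
have [d dk [_ [Id _]]] := small_olt Ik.
case: (pselect (exists i0 : I, True)) => [[i0 _]|I0].
  have [g gs] := embeds_surj i0 Id.
  exists d, (A \o g); split=> //=.
  apply/seteqP; split=> x [i _ Aix]; last by exists (g i).
  by have [j ji] := gs i; exists j => //=; rewrite ji.
exists (ofin 0), (fun=> set0).
split=> [|[]|] //.
  apply: olt0 => /oeq_embeds/(embeds_trans nat_k)[f _].
  by case: (f 0).
by apply/seteqP; split=> x [i _]; [case: I0; exists i|case: i].
Qed.

Lemma small_unit : small unit.
Proof. by apply: (small_finite nat_k); exact: finite_finset. Qed.

Lemma Sigma1p_compl (a b : Ord) U : olt b a -> Sigma1p b (~` U) -> Sigma1p a U.
Proof.
move=> ba SU; apply/Sigma1p_union.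
  by apply: olt0 => a0; exact: nolt0 (olt_oeq ba a0).
exists unit, (fun=> U); split; first exact: small_unit.
  by move=> _; exists b.
by apply/seteqP; split=> x; [exists tt|case].
Qed.

Lemma Sigma1p_complC (a b : Ord) U :
  olt b a -> Sigma1p b U -> Sigma1p a (~` U).
Proof. by move=> ba SU; apply: Sigma1p_compl ba _; rewrite setCK. Qed.

(** Only the passage from level [0] upwards requires an argument: open sets are
    unions of fewer than [k] closed sets by hypothesis. *)
Lemma Sigma1p_mono (a b : Ord) U : olt b a -> Sigma1p b U -> Sigma1p a U.
Proof.
move=> ba SU; have a0 : olt (ofin 0) a.
  by apply: olt0 => a0; exact: nolt0 (olt_oeq ba a0).
case: (pselect (oeq b (ofin 0))) => [b0|/olt0 b0].
  have /Sigma1p_open/X_open[//|F [Fk Fc ->]] := SU.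
  apply/Sigma1p_union => //; exists {C | F C}, sval; split.
  - exact: small_sub (iffLR (card_le_embeds _ _) Fk) (small_cof k_singular).
  - move=> [C FC]; exists b => //=; apply/Sigma1p_open => //.
    by apply: closed_openC; exact: Fc.
  - apply/seteqP; split=> x [C FC xC]; first by exists (exist _ C FC).
    by exists (sval C) => //; exact: svalP.
have [I [A [Ik AP ->]]] := iffLR (Sigma1p_union U b0) SU.
apply/Sigma1p_union => //; exists I, A; split=> // i; have [c cb SA] := AP i.
by exists c => //; exact: olt_trans ba.
Qed.

Lemma Sigma1p_mono_le (a b : Ord) U :
  olt b a \/ oeq b a -> Sigma1p b U -> Sigma1p a U.
Proof. by case; [exact: Sigma1p_mono|exact: Sigma1p_oeq]. Qed.

Lemma Sigma1p_succ (a b : Ord) U : oeq a (osucc b) -> Sigma1p a U <->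
  exists (I : Type) (A : I -> set X),
    [/\ small I, forall i, Sigma1p b (~` A i) & U = \bigcup_i A i].
Proof.
move=> ab; have ba : olt b a := olt_oeq (olt_succr b) (oeq_sym ab).
rewrite Sigma1p_union; last by apply: olt0 => a0; exact: nolt0 (olt_oeq ba a0).
split=> -[I [A [Ik AP ->]]]; exists I, A; split=> // i; last by exists b.
have [c ca SA] := AP i; apply: Sigma1p_mono_le SA.
by apply/olt_succ; exact: olt_oeq ab.
Qed.

Definition cup_le (a : Ord) : Prop := forall I (A : I -> set X),
  I <~ k -> (forall i, Sigma1p a (A i)) -> Sigma1p a (\bigcup_i A i).

Definition cup_lt (n a : Ord) : Prop := forall I (A : I -> set X),
  ~ n <~ I -> (forall i, Sigma1p a (A i)) -> Sigma1p a (\bigcup_i A i).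

Definition cap_lt (n a : Ord) : Prop := forall I (A : I -> set X),
  ~ n <~ I -> (forall i, Sigma1p a (A i)) -> Sigma1p a (\bigcap_i A i).

(** The type [J] does not depend on [U]: when a family of sets of level [a] is
    intersected, the distributed union is indexed by functions into [J]. *)
Definition short_unions (a : Ord) : Prop := exists2 J : Type, small J &
  forall U, Sigma1p a U -> exists2 B : J -> set X,
    (forall j, Sigma1p a (~` B j)) & U = \bigcup_j B j.

Lemma bigcap_bigcup I J T (B : I -> J -> set T) :
  \bigcap_i \bigcup_j B i j = \bigcup_(f : I -> J) \bigcap_i B i (f i).
Proof.
apply/seteqP; split=> [x xB|x [f _ fB] i _]; last by exists (f i) => //; exact: fB.
have [f fP] : {f & forall i, B i (f i) x}.
  apply: (@choice _ _ (fun i j => B i j x)) => i.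
  by have [j] := xB i Logic.I; exists j.
by exists f => // i _; exact: fP.
Qed.

Lemma bigcup_sigT T I (J : I -> Type) (B : forall i, J i -> set T) :
  \bigcup_i \bigcup_j B i j = \bigcup_s B (projT1 s) (projT2 s).
Proof.
apply/seteqP; split=> [x [i _ [j _ xB]]|x [[i j] _ xB]].
  by exists (existT _ i j).
by exists i => //; exists j.
Qed.

Lemma bigcup_fibers T I J (h : I -> J) (A : I -> set T) :
  \bigcup_i A i = \bigcup_j \bigcup_(u : {i | h i = j}) A (sval u).
Proof.
apply/seteqP; split=> [x [i _ xA]|x [j _ [u _ xA]]]; last by exists (sval u).
by exists (h i) => //; exists (exist (fun i' => h i' = h i) i erefl).
Qed.

Lemma short_unions0 (a : Ord) : oeq a (ofin 0) -> short_unions a.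
Proof.
move=> a0; exists (cof k); first exact: small_cof.
move=> U /(Sigma1p_open _ a0)/X_open[F [/card_le_embeds[e ei] Fc ->]].
(* By injectivity of [e] each of these unions has at most one member; the empty
   one, over the points [j] outside the range of [e], is closed as well. *)
exists (fun j => \bigcup_(u in [set u | e u = j]) sval u).
  move=> j; apply/(Sigma1p_open _ a0)/closed_openC.
  case: (pselect (exists u, e u = j)) => [[u uj]|nj].
    rewrite (_ : bigcup _ _ = sval u); first by apply: Fc; exact: (svalP u).
    apply/seteqP; split=> [x [v /= vj xv]|x xu]; last by exists u.
    by move: xv; rewrite (ei v u) // vj.
  rewrite (_ : bigcup _ _ = set0); first exact: closed0.
  by apply/seteqP; split=> // x [v /= vj _]; case: nj; exists v.
apply/seteqP; split=> [x [C FC xC]|x [j _ [u _ xu]]].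
  by exists (e (exist _ C FC)) => //; exists (exist _ C FC).
by exists (sval u) => //; exact: svalP.
Qed.

Lemma Sigma1p_succ_family (a b : Ord) T (U : T -> set X) :
  oeq a (osucc b) -> (forall t, Sigma1p a (U t)) ->
  exists (I : T -> Type) (A : forall t, I t -> set X), forall t,
    [/\ small (I t), forall i, Sigma1p b (~` A t i) & U t = \bigcup_i A t i].
Proof.
move=> ab SU; have h t := iffLR (Sigma1p_succ (U t) ab) (SU t).
exists (fun t => projT1 (cid (h t))).
exists (fun t => projT1 (cid (projT2 (cid (h t))))) => t.
exact: projT2 (cid (projT2 (cid (h t)))).
Qed.

(** The complement of a union of fewer than [k] sets [A i] of [P b] is the
    intersection of the [~` A i], each a [J]-union of sets of [P b]: distribute,
    using that there are fewer than [k] functions from [I] to [J]. *)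
Lemma odd_compl (a b : Ord) : oeq a (osucc b) -> cup_le b -> short_unions b ->
  forall U, Sigma1p a U -> Sigma1p a (~` U).
Proof.
move=> ab cb [J Jk JP] U /(Sigma1p_succ _ ab)[I [A [Ik AP ->]]].
have h i : exists B : J -> set X,
    (forall j, Sigma1p b (~` B j)) /\ ~` A i = \bigcup_j B j.
  by have [B SB AB] := JP _ (AP i); exists B.
have [B BP] := choice h.
apply/(Sigma1p_succ _ ab).
exists (I -> J), (fun f => \bigcap_i B i (f i)); split.
- exact: small_fun.
- move=> f; rewrite setC_bigcap; apply: cb => [|i]; last by case: (BP i).
  exact: small_embeds.
- rewrite setC_bigcup -bigcap_bigcup; apply: eq_bigcapr => i _.
  by case: (BP i).
Qed.

(** A union of unions is a union over the sum of the index types, which is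
    small by [small_sum]. *)
Lemma succ_cup_lt (a b : Ord) : oeq a (osucc b) -> cup_lt (cof k) a.
Proof.
move=> ab T U Tk SU.
have [I [A AP]] := Sigma1p_succ_family ab SU.
apply/(Sigma1p_succ _ ab).
exists {t : T & I t}, (fun s => A (projT1 s) (projT2 s)); split.
- by apply: small_sum => // t; case: (AP t).
- by move=> [t i] /=; case: (AP t).
- by rewrite -bigcup_sigT; apply: eq_bigcupr => t _; case: (AP t).
Qed.

(** The common part of the successor and limit cases. [L] is a class of sets of
    lower level generating level [a] by small unions, and the last hypothesis
    says that unions of size [k] of sets of [L] reduce to unions of the fixed
    small size [J]. Intersections of [T] sets of level [a] then distribute into
    unions over [T -> J] of intersections of [T] sets of [L]. *)
Lemma even_step (a : Ord) (L : set (set X)) (J : Type) : small J ->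
  (forall U, Sigma1p a U -> exists (I : Type) (A : I -> set X),
     [/\ I <~ k, forall i, L (A i) & U = \bigcup_i A i]) ->
  (forall (I : Type) (A : I -> set X), small I -> (forall i, L (A i)) ->
     Sigma1p a (\bigcup_i A i)) ->
  (forall A, L A -> Sigma1p a (~` A)) ->
  (forall (I : Type) (A : I -> set X), I <~ k -> (forall i, L (A i)) ->
     exists2 B : J -> set X, (forall j, L (B j)) &
       \bigcup_i A i = \bigcup_j B j) ->
  [/\ cup_le a, short_unions a &
    forall T, small T ->
      (forall A : T -> set X, (forall t, L (A t)) -> L (\bigcap_t A t)) ->
    forall A : T -> set X,
      (forall t, Sigma1p a (A t)) -> Sigma1p a (\bigcap_t A t)].
Proof.
move=> Jk SL LS LC LJ.
have SJ U : Sigma1p a U ->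
    exists B : J -> set X, (forall j, L (B j)) /\ U = \bigcup_j B j.
  move=> /SL[I [A [Ik AP ->]]]; have [B LB ->] := LJ _ _ Ik AP.
  by exists B.
have Lk I (A : I -> set X) :
    I <~ k -> (forall i, L (A i)) -> Sigma1p a (\bigcup_i A i).
  by move=> Ik AP; have [B LB ->] := LJ _ _ Ik AP; exact: LS.
split.
- move=> I A Ik SA; have [B BP] := choice (fun i => SJ _ (SA i)).
  rewrite (_ : \bigcup_i A i = \bigcup_i \bigcup_j B i j); last first.
    by apply: eq_bigcupr => i _; case: (BP i).
  rewrite bigcup_sigT; apply: Lk => [|[i j] /=]; last by case: (BP i).
  by apply: sum_embeds => // _; exact: small_embeds.
- exists J => // U /SJ[B [LB ->]]; exists B => // j; exact/LC.
- move=> T Tk capL A SA; have [B BP] := choice (fun t => SJ _ (SA t)).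
  rewrite (_ : \bigcap_t A t = \bigcap_t \bigcup_j B t j); last first.
    by apply: eq_bigcapr => t _; case: (BP t).
  rewrite bigcap_bigcup; apply: LS => [|f]; first exact: small_fun.
  by apply: capL => t; case: (BP t).
Qed.

(** Here [L] is level [b]. A union of [k] sets of level [b] is a union of [k]
    sets of [P c], and grouping the latter along [small_fibers] gives [cof k]
    small unions, each of level [b] again. *)
Lemma even_succ_step (a b c : Ord) : oeq a (osucc b) -> oeq b (osucc c) ->
  (forall U, Sigma1p b U -> Sigma1p b (~` U)) -> cup_lt (cof k) b ->
  [/\ cup_le a, short_unions a & cap_lt (cof k) a].
Proof.
move=> ab bc bC bU; have ba := olt_oeq (olt_succr b) (oeq_sym ab).
have [|U|I A Ik SA|A SA|I A Ik SA|cu su ca] := @even_step a (Sigma1p b) (cof k).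
- exact: small_cof.
- move=> /(Sigma1p_succ _ ab)[I [A [Ik AP ->]]]; exists I, A; split=> // [|i].
    exact: small_embeds.
  by rewrite -(setCK (A i)); exact: bC.
- by apply/(Sigma1p_succ _ ab); exists I, A; split=> // i; exact: bC.
- exact: Sigma1p_complC ba SA.
- have [J [B BP]] := Sigma1p_succ_family bc SA.
  rewrite (_ : \bigcup_i A i = \bigcup_i \bigcup_j B i j); last first.
    by apply: eq_bigcupr => i _; case: (BP i).
  rewrite bigcup_sigT; set D := fun s : {i : I & J i} => _.
  have [|g gP] := @small_fibers k k_singular {i : I & J i}.
    by apply: sum_embeds => // i; apply: small_embeds; case: (BP i).
  exists (fun m => \bigcup_(u : {s | g s = m}) D (sval u)); last first.
    exact: bigcup_fibers.
  move=> m; apply/(Sigma1p_succ _ bc).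
  exists {s | g s = m}, (D \o sval); split=> //.
  by move=> [[i j] gm]; have [_ SB _] := BP i; exact: SB.
split=> // T A Tk SA; apply: ca SA => // [|B SB]; first exact: small_cof_lt Tk.
rewrite -[\bigcap_t B t]setCK setC_bigcap; apply: (bC); apply: bU => // t.
exact: bC.
Qed.

(** Here [L] is the class of sets of level below [a]. A union of [k] of them is
    grouped by a cofinal sequence of levels, each group being placed at an even
    level, where unions of size [k] are available. Fewer than [cof a] sets lie
    in a common level below [a], whence closure of [L] under intersections. *)
Lemma limit_step (a : Ord) : is_limit a -> a <~ k ->
  (forall b, is_even b -> olt b a -> cup_le b) ->
  [/\ cup_le a, short_unions a & cap_lt (cof a) a].
Proof.
move=> la ak IH; have a0 : olt (ofin 0) a by apply: olt0; case: la.
have evx (x : a) : exists e, [/\ is_even e, olt (seg x) e & olt e a].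
  by apply: limit_even => //; exact: seg_olt.
pose L (A : set X) := exists x : a, Sigma1p (seg x) (~` A).
have LE A : L A <-> exists2 b, olt b a & Sigma1p b (~` A).
  split=> [[x SA]|[b [x bx] SA]]; last by exists x; exact: Sigma1p_oeq bx SA.
  by exists (seg x) => //; exact: seg_olt.
have [|U|I A Ik LA|A /LE[b ba SA]|I A Ik LA|cu su ca] := @even_step a L (cof a).
- exact: small_cof_le.
- move=> /(Sigma1p_union _ a0)[I [A [Ik AP ->]]]; exists I, A; split=> // [|i].
    exact: small_embeds.
  exact/LE.
- by apply/(Sigma1p_union _ a0); exists I, A; split=> // i; exact/LE.
- exact: Sigma1p_mono ba SA.
- have [x xP] := choice LA; have [c cc] := cof_cofinal a.
  have [j jP] := choice (fun i => cc (x i)).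
  have [e eP] := choice (fun m => evx (c m)).
  exists (fun m => \bigcup_(u : {i | j i = m}) A (sval u)); last first.
    exact: bigcup_fibers.
  move=> m; have [ev ce ea] := eP m.
  apply/LE; exists (osucc (e m)); first exact: limit_succ.
  apply: Sigma1p_complC (olt_succr _) _; apply: IH => //.
    exact: embeds_trans (embeds_sig _) Ik.
  move=> [i ij] /=; apply: Sigma1p_compl (xP i).
  by move: (jP i); rewrite ij => -[/olt_seg h|-> //]; exact: olt_trans h ce.
split=> // T A Tk SA; have Tks : small T.
  move=> /(embeds_trans ak) aT; apply: Tk.
  exact: embeds_trans (cof_embeds a) aT.
apply: ca SA => // B LB.
have [x xP] := choice LB; have [y xy] := cof_bounded x Tk.
have [e [ev ye ea]] := evx y; apply/LE; exists e => //.
rewrite setC_bigcap; apply: IH => // [|t]; first exact: small_embeds.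
apply: Sigma1p_mono (xP t); exact: olt_trans (olt_seg (xy t)) ye.
Qed.

Lemma cof_hat_limit (a : Ord) : is_limit a -> cof_hat k a = cof a.
Proof. by rewrite /cof_hat; case: pselect. Qed.

Lemma cof_hatN (a : Ord) : ~ is_limit a -> cof_hat k a = cof k.
Proof. by rewrite /cof_hat; case: pselect. Qed.

(** The induction starts from level [0], where unions of size [k] come from the
    topology and [short_unions] from the hypothesis on open sets; additivity is
    the form that closure under intersections takes at that level. *)
Lemma closure_properties (a : Ord) : a <~ k ->
  (is_even a -> [/\ cup_le a, short_unions a &
     (olt (ofin 0) a \/ additive X (cof k)) -> cap_lt (cof_hat k a) a]) /\
  (is_odd a -> (forall U, Sigma1p a U -> Sigma1p a (~` U)) /\ cup_lt (cof k) a).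
Proof.
elim/(well_founded_ind olt_wf): a => a IH ak.
have IHa b : olt b a -> b <~ k by move=> /olt_embeds ba; exact: embeds_trans ba ak.
split=> [/even_cases[a0|la|[b /odd_cases[c cE bc] ab]]|/odd_cases[b bE ab]].
- have na : ~ is_limit a by case.
  split=> [I A _ SA||[/olt_oeq/(_ a0)/nolt0 //|add I A]].
  + by apply/(Sigma1p_open _ a0)/bigcup_open => i _; exact/(Sigma1p_open _ a0).
  + exact: short_unions0.
  + rewrite (cof_hatN na) => Ik SA; apply/(Sigma1p_open _ a0).
    rewrite (_ : bigcap _ _ = \bigcap_(U in A @` setT) U); last first.
      by rewrite bigcap_image.
    apply: add => [_ [i _ <-]|].
      exact/(Sigma1p_open _ a0)/SA.
    apply/card_lt_embeds => h; apply: Ik; apply: embeds_trans h _.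
    have e (u : {U | (A @` setT) U}) : exists i, A i = sval u.
      by have [i _ AU] := svalP u; exists i.
    have [g gP] := choice e; exists g => u v uv; apply: sval_inj.
    by rewrite -!gP uv.
- have [|cu su ca] := limit_step la ak.
    by move=> b bE ba; case: (IH b ba (IHa b ba)) => /(_ bE)[].
  by split=> [||_]; [exact: cu|exact: su|rewrite cof_hat_limit].
- have cb := olt_oeq (olt_succr c) (oeq_sym bc).
  have ba := olt_oeq (olt_succr b) (oeq_sym ab).
  have [_ /(_ (even_succ cE bc))[bC bU]] := IH b ba (IHa b ba).
  have [cu su ca] := even_succ_step ab bc bC bU.
  split=> [||_]; [exact: cu|exact: su|rewrite cof_hatN //].
  by move=> [_]; apply; exists b.
- have ba := olt_oeq (olt_succr b) (oeq_sym ab).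
  have [/(_ bE)[cb sb _] _] := IH b ba (IHa b ba).
  by split; [exact: odd_compl ab cb sb|exact: succ_cup_lt ab].
Qed.

(** * Families of sets in place of indexed families *)

Lemma bigcup_sig T (F : set (set T)) :
  \bigcup_(A in F) A = \bigcup_(u : {A | F A}) sval u.
Proof.
apply/seteqP; split=> x [A FA xA]; first by exists (exist _ A FA).
by exists (sval A) => //; exact: svalP.
Qed.

Lemma bigcap_sig T (F : set (set T)) :
  \bigcap_(A in F) A = \bigcap_(u : {A | F A}) sval u.
Proof.
apply/seteqP; split=> x h A FA; first by apply: h; exact: (svalP A).
exact: (h (exist _ A FA)).
Qed.

Lemma even_conclusion (n a : Ord) : is_cardinal n -> n <~ k ->
  cup_le a -> cap_lt n a ->
  [/\ closed_bigcup_le k (Sigma1p a) /\ closed_bigcap_lt n (Sigma1p a),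
      closed_bigcap_le k (@Pi X k (oneadd a)) /\
        closed_bigcup_lt n (@Pi X k (oneadd a)) &
      algebra n (@Delta X k (oneadd a))].
Proof.
move=> nc nk cu ca.
have PP U : @Pi X k (oneadd a) U <-> Sigma1p a (~` U) by exact: PiE.
split; first split.
- move=> F FS /card_le_embeds Fk; rewrite bigcup_sig; apply: cu => // u.
  by apply: FS; exact: (svalP u).
- move=> F FS /card_lt_embeds Fn; rewrite bigcap_sig; apply: ca => // u.
  by apply: FS; exact: (svalP u).
- split=> F FP => [/card_le_embeds Fk|/card_lt_embeds Fn]; apply/PP.
    rewrite bigcap_sig setC_bigcap; apply: cu => // u.
    by apply/PP/FP; exact: (svalP u).
  rewrite bigcup_sig setC_bigcup; apply: ca => // u.
  by apply/PP/FP; exact: (svalP u).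
- split=> [A [SA /PP PA]|d A dn DA]; first by split=> //; apply/PP; rewrite setCK.
  have dn' := cardinal_olt nc dn; split.
    apply: cu => [|i]; last by case: (DA i).
    exact: embeds_trans (olt_embeds dn) nk.
  apply/PP; rewrite setC_bigcup; apply: ca => // i.
  by case: (DA i) => _ /PP.
Qed.

Lemma odd_conclusion (a : Ord) : (forall U, Sigma1p a U -> Sigma1p a (~` U)) ->
  cup_lt (cof k) a ->
  [/\ Sigma1p a = @Pi X k (oneadd a),
      @Pi X k (oneadd a) = @Delta X k (oneadd a) &
      algebra (cof k) (@Delta X k (oneadd a))].
Proof.
move=> cC cu; have SP : Sigma1p a = @Pi X k (oneadd a).
  apply/seteqP; split=> U; first by move=> /cC SU; exact/PiE.
  by move=> /PiE/cC; rewrite setCK.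
have DS : @Delta X k (oneadd a) = Sigma1p a by rewrite /Delta -SP setIid.
rewrite DS; split=> //; split=> // d A dk SA; apply: cu => //.
exact: (cardinal_olt (@cof_cardinal k) dk).
Qed.

End Hierarchy.

Theorem proposition5p4 (k : Ord) (X : topologicalType)
    (k_singular : singular k)
    (k_pow : oeq (weak_pow2 k) k)
    (X_nonempty : [set: X] !=set0)
    (X_regular : regular_space X)
    (X_hausdorff : hausdorff_space X)
    (X_weight : weight_le X k)
    (X_open : forall U : set X, open U ->
       exists F : set (set X),
         [/\ F #<= [set: cof k], F `<=` closed & U = \bigcup_(C in F) C]) :
  let conclusion (a : Ord) :=
    let S := @Sigma X k (oadd (ofin 1) a) in
    let P := @Pi X k (oadd (ofin 1) a) in
    let D := @Delta X k (oadd (ofin 1) a) in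
    (is_even a ->
       [/\ closed_bigcup_le k S /\ closed_bigcap_lt (cof_hat k a) S,
           closed_bigcap_le k P /\ closed_bigcup_lt (cof_hat k a) P &
           algebra (cof_hat k a) D]) /\
    (is_odd a -> [/\ S = P, P = D & algebra (cof k) D]) in
  (forall a : Ord, olt (ofin 0) a -> olt a (succ_card k) -> conclusion a) /\
  (additive X (cof k) -> conclusion (ofin 0)).
Proof.
move=> conclusion.
have main (a : Ord) :
    a <~ k -> olt (ofin 0) a \/ additive X (cof k) -> conclusion a.
  move=> ak a0.
  have [evenP oddP] := closure_properties k_singular k_pow X_open ak.
  split=> [/evenP[cu _ /(_ a0) ca]|/oddP[cC cu]]; last exact: odd_conclusion.
  case: (pselect (is_limit a)) => [la|nla].
    move: ca; rewrite (cof_hat_limit k la); apply: even_conclusion => //.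
      exact: cof_cardinal.
    exact: embeds_trans (cof_embeds a) ak.
  move: ca; rewrite (cof_hatN k nla); apply: even_conclusion => //.
    exact: cof_cardinal.
  exact: cof_embeds.
split=> [a a0 /olt_succ_card ak|add]; apply: main => //; [by left| |by right].
by exists (fun i : ofin 0 => False_rect k (notF (ltn_ord i))) => -[].
Qed.
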